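(* Let $R$ be a commutative local ring of bounded module type. Suppose there exists a nonmaximal prime ideal $J$ of $R$ such that $R/J$ is almost maximal. Then $R$ is an almost maximal valuation ring.
   Context: All rings are associative, commutative, with identity. Local means having a unique maximal ideal (no Noetherian hypothesis). A ring $R$ has bounded module type if, for some positive integer $n$, every finitely generated $R$-module is a direct sum of submodules each generated by at most $n$ elements. A valuation ring is a ring (possibly with zero-divisors) whose ideals are totally ordered by inclusion; every local ring of bounded module type is a valuation ring, and hence so are its nonzero factor rings. A valuation ring $S$ is almost maximal if every family of cosets $\{r_\lambda+I_\lambda\mid\lambda\in\Lambda\}$ ($r_\lambda\in S$, $I_\lambda$ an ideal of $S$) which is totally ordered by inclusion and satisfies $\bigcap_{\lambda\in\Lambda}I_\lambda\neq 0$ has nonempty intersection. *)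

(* Defs.v *)
From HB Require Import structures.
From mathcomp Require Import all_boot all_algebra ring_quotient.
From mathcomp Require Import finmap.

Set Implicit Arguments.
Unset Strict Implicit.
Unset Printing Implicit Defensive.

Import GRing.Theory.
Local Open Scope ring_scope.

(* Ideals and submodules are boolean predicates, as in ssralg and            *)
(* ring_quotient; this is no restriction in the presence of classical        *)
(* axioms, which turn every Prop-valued predicate into a boolean one.        *)

(* Unlike idealr of ring_quotient, the ideal may be the whole ring.          *)
Definition ideal (R : comNzRingType) (I : {pred R}) : Prop :=
  @GRing.submod_closed R R^o I.

Definition maximal_ideal (R : comNzRingType) (m : {pred R}) : Prop :=
  [/\ ideal m, 1 \notin m &
      forall I : {pred R}, ideal I -> {subset m <= I} -> 1 \notin I -> I =i m].

Definition local_ring (R : comNzRingType) : Prop :=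
  exists2 m : {pred R}, maximal_ideal m &
    forall m' : {pred R}, maximal_ideal m' -> m' =i m.

Definition valuation_ring (R : comNzRingType) : Prop :=
  forall I J : {pred R}, ideal I -> ideal J ->
    {subset I <= J} \/ {subset J <= I}.

Definition generated_by (R : comNzRingType) (M : lmodType R)
    (g : seq M) (N : {pred M}) : Prop :=
  forall x : M, x \in N <->
    exists c : 'I_(size g) -> R, x = \sum_(i < size g) c i *: g`_i.

Definition finitely_generated (R : comNzRingType) (M : lmodType R) : Prop :=
  exists g : seq M, generated_by g predT.

(* Internal direct sum over an arbitrary, possibly infinite, index type.     *)
Definition is_direct_sum (R : comNzRingType) (M : lmodType R)
    (K : choiceType) (N : K -> {pred M}) : Prop :=
  (forall k, GRing.submod_closed (N k)) /\
  forall x : M, exists! f : {fsfun K -> M with 0},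
    (forall k, f k \in N k) /\ x = \sum_(k <- finsupp f) f k.

Definition bounded_module_type (R : comNzRingType) : Prop :=
  exists2 n : nat, (0 < n)%N &
    forall M : lmodType R, finitely_generated M ->
      exists (K : choiceType) (N : K -> {pred M}),
        is_direct_sum N /\
        forall k, exists2 g : seq M, (size g <= n)%N & generated_by g (N k).

Definition coset (R : comNzRingType) (r : R) (I : {pred R}) : {pred R} :=
  [pred x | x - r \in I].

(* The linear compactness condition alone: that the ring is a valuation ring *)
(* is a separate predicate.                                                  *)
Definition almost_maximal (S : comNzRingType) : Prop :=
  forall (L : Type) (r : L -> S) (I : L -> {pred S}),
    (forall l, ideal (I l)) ->
    (forall l l', {subset coset (r l) (I l) <= coset (r l') (I l')} \/
                  {subset coset (r l') (I l') <= coset (r l) (I l)}) ->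
    (exists2 y : S, y != 0 & forall l, y \in I l) ->
    exists x : S, forall l, x \in coset (r l) (I l).

(* Main.v *)
From HB Require Import structures.
From mathcomp Require Import boolp classical_sets.
Require Import Defs.
From mathcomp Require Import all_boot all_algebra ring_quotient.
From mathcomp Require Import finmap ring zify.

Set Implicit Arguments.
Unset Strict Implicit.
Unset Printing Implicit Defensive.

Import GRing.Theory.
Local Open Scope ring_scope.

(** Let m be the maximal ideal and let every finitely generated module be a
    direct sum of n-generated ones.  Bounded module type enters only through
    matrices (bounded_module_type_matrix): if K is a submodule of m R^N, the
    projections of R^N/K onto its summands lift to N x N matrices that preserve K
    and add up to the identity modulo K, while each of them factors modulo K
    through n generators, so that its (n+1)-minors lie in m.  Hence no module
    R^N/K can exist for which every such matrix with a unit in one prescribed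
    place has n+1 rows and columns on which it is triangular modulo m with units
    on the diagonal.  Each half of the theorem exhibits a forbidden module.

    If neither of a, b divides the other, the relations a e_i = b e_(i+1), taken
    modulo a m + b m, form a Kronecker pencil: an endomorphism is a triangular
    Toeplitz matrix modulo m.  So R is a valuation ring.

    If R is not almost maximal, some coherent system of residues r a modulo a,
    for a outside an ideal I != 0, has no pseudo-limit xi in R.  When u a lies in
    I for some a outside I and u outside J, dividing the system by a turns it into
    a system of R/J whose intersection contains u != 0, and almost maximality of
    R/J solves it (pseudo_limit_saturated).  So I is saturated with respect to
    the complement of J.  Then xi satisfies no relation u xi = v modulo all
    a outside I with u outside J (linear_pseudo_limit).  As J is not maximal, pick
    s in m outside J; every power of s divides all elements of J, hence of I.

    Put q = n+1 and consider the module generated by e_0, ..., e_(q-1) and f, where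
    s^(q i) d0 kills e_i and f stands for xi (e_0 + s e_1 + ... + s^(q-1) e_(q-1)).
    The growing annihilator exponents make the e-block of an endomorphism
    triangular modulo m: the coefficient at e_i of the image of e_j is divisible
    by s^(i+1) for j < i (limit_relations_lower).  The image of f is computed in two ways, which gives
    for each coordinate a quadratic equation in xi; subtracting s^i times the
    equation for the coordinate 0 from that for i removes the quadratic term, and
    the remaining linear relation forces the vector of the s^i to be an
    eigenvector modulo J (limit_relations_eigen).  Together these make the
    diagonal of the e-block constant modulo m, which is forbidden. *)

(** * Ideals and units of a local ring *)

Definition divides (R : comNzRingType) (a x : R) : Prop := exists c, x = a * c.

Section Ideals.
Variables (R : comNzRingType) (I : {pred R}).
Hypothesis idI : ideal I.

Lemma ideal0 : 0 \in I. Proof. by case: idI. Qed.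

Lemma idealD x y : x \in I -> y \in I -> x + y \in I.
Proof. by move=> xI yI; have := idI.2 1 x y xI yI; rewrite scale1r. Qed.

Lemma ideal_mull a x : x \in I -> a * x \in I.
Proof. by move=> xI; have := idI.2 a x 0 xI ideal0; rewrite addr0. Qed.

Lemma ideal_mulr a x : x \in I -> x * a \in I.
Proof. by rewrite mulrC; apply: ideal_mull. Qed.

Lemma idealN x : x \in I -> - x \in I.
Proof. by rewrite -mulN1r; apply: ideal_mull. Qed.

Lemma idealB x y : x \in I -> y \in I -> x - y \in I.
Proof. by move=> xI yI; apply: idealD => //; apply: idealN. Qed.

Lemma ideal_sum (J : Type) (r : seq J) (Q : pred J) (F : J -> R) :
  (forall i, Q i -> F i \in I) -> \sum_(i <- r | Q i) F i \in I.
Proof. by move=> FI; elim/big_ind: _ => //; [apply: ideal0 | apply: idealD]. Qed.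

Lemma ideal_prodB (J : Type) (r : seq J) (Q : pred J) (F G : J -> R) :
  (forall i, Q i -> F i - G i \in I) ->
  \prod_(i <- r | Q i) F i - \prod_(i <- r | Q i) G i \in I.
Proof.
move=> FG; elim/big_ind2: _ => //; first by rewrite subrr ideal0.
move=> x2 x1 y2 y1 x12 y12.
have ->: x1 * y1 - x2 * y2 = (x1 - x2) * y1 + x2 * (y1 - y2).
  by rewrite mulrBl mulrBr addrA subrK.
by apply: idealD; [apply: ideal_mulr | apply: ideal_mull].
Qed.

Lemma ideal_detB n (A B : 'M[R]_n) :
  (forall i j, A i j - B i j \in I) -> \det A - \det B \in I.
Proof.
move=> AB; rewrite /determinant -sumrB; apply: ideal_sum => s _.
by rewrite -mulrBr; apply/ideal_mull/ideal_prodB.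
Qed.

End Ideals.

Definition principal (R : comNzRingType) (a : R) : {pred R} :=
  fun x => `[< divides a x >].

Lemma principalP (R : comNzRingType) (a x : R) :
  reflect (divides a x) (x \in principal a).
Proof. exact: asboolP. Qed.

Lemma ideal_principal (R : comNzRingType) (a : R) : ideal (principal a).
Proof.
split=> [|b x y]; first by apply/principalP; exists 0; rewrite mulr0.
move=> /principalP[c ->] /principalP[d ->]; apply/principalP; exists (b * c + d).
by rewrite mulrDr mulrCA.
Qed.

(** Zorn's lemma puts any non-unit into a maximal ideal, hence into the only one. *)
Lemma local_nonmem_unit (R : comNzRingType) (m : {pred R}) :
  (forall m' : {pred R}, maximal_ideal m' -> m' =i m) ->
  forall x, x \notin m -> exists y, x * y = 1.
Proof.
move=> m_uniq x xm; apply: contrapT => xnu.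
pose T := {I : R -> bool | [/\ ideal I, 1 \notin I & x \in I]}.
pose le (I J : T) := `[< {subset sval I <= sval J} >].
have I0 : T.
  exists (principal x); split; first exact: ideal_principal.
    by apply/principalP => -[y y1]; apply: xnu; exists y.
  by apply/principalP; exists 1; rewrite mulr1.
have chain A : total_on A le -> exists t, forall s, A s -> le s t.
  move=> Atot; have [[I1 AI1]|A0] := pselect (exists I1, A I1); last first.
    by exists I0 => s As; case: A0; exists s.
  pose U : {pred R} := fun z => `[< exists2 I, A I & z \in sval I >].
  have idU : ideal U.
    split=> [|a u v].
      by apply/asboolP; exists I1 => //; apply: ideal0; case: (svalP I1).
    move=> /asboolP[I AI uI] /asboolP[J AJ vJ].
    have [IJ|JI] := Atot _ _ AI AJ; apply/asboolP.
      exists J => //; have [[_ +] _ _] := svalP J; apply=> //.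
      by move/asboolP: IJ; apply.
    exists I => //; have [[_ +] _ _] := svalP I; apply=> //.
    by move/asboolP: JI; apply.
  have U1 : 1 \notin U.
    by apply/asboolP => -[I AI]; apply/negP; case: (svalP I).
  have Ux : x \in U by apply/asboolP; exists I1 => //; case: (svalP I1).
  exists (exist _ U (And3 idU U1 Ux)) => s As; apply/asboolP => z zs.
  by apply/asboolP; exists s.
have [|r s t /asboolP rs /asboolP st|M Mmax] := ZL_preorder I0 _ _ chain.
- by move=> t; apply/asboolP.
- by apply/asboolP => z /rs /st.
have [idM M1 Mx] := svalP M.
suff /m_uniq /(_ x) : maximal_ideal (sval M) by rewrite Mx (negbTE xm).
split=> // I idI MI I1 z; apply/idP/idP; last exact: MI.
have Ix : x \in I by apply: MI.
have /asboolP : le (exist _ I (And3 idI I1 Ix)) M by apply/Mmax/asboolP.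
by apply.
Qed.

(** * Summands of finitely generated modules as matrices *)

Section QuotientModule.
Variables (R : comNzRingType) (V : lmodType R) (K : {pred V}).
Hypothesis smK : GRing.submod_closed K.

Local Definition zmodK : zmodClosed V :=
  HB.pack K (GRing.isZmodClosed.Build V K (GRing.submod_closedB smK)).

Definition quotmod := {ideal_quot zmodK}.
HB.instance Definition _ := GRing.Zmodule.on quotmod.

Definition modpi (v : V) : quotmod := \pi_{ideal_quot zmodK}%qT v.
Definition modrepr (x : quotmod) : V := repr x.

Lemma modreprK : cancel modrepr modpi. Proof. exact: reprK. Qed.

Lemma modpi_eq u v : (modpi u == modpi v) = (u - v \in K).
Proof. by rewrite -(Quotient.idealrBE zmodK). Qed.

Lemma modpi_eq0 v : (modpi v == 0) = (v \in K).
Proof. by rewrite -[v in RHS]subr0 -modpi_eq /modpi raddf0. Qed.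

Definition scaleq (a : R) (x : quotmod) : quotmod := modpi (a *: modrepr x).

Lemma modpiD : {morph modpi : u v / u + v}.
Proof. by move=> u v; rewrite /modpi raddfD. Qed.

Lemma scaleq_pi a v : scaleq a (modpi v) = modpi (a *: v).
Proof.
apply/eqP; rewrite modpi_eq -scalerBr -[_ *: _]addr0.
by apply: smK.2 smK.1; rewrite -modpi_eq modreprK.
Qed.

Lemma scaleqA a b x : scaleq a (scaleq b x) = scaleq (a * b) x.
Proof. by rewrite -[x]modreprK !scaleq_pi scalerA. Qed.
Lemma scale1q : left_id 1 scaleq.
Proof. by move=> x; rewrite -[x]modreprK scaleq_pi scale1r. Qed.
Lemma scaleqDr : right_distributive scaleq +%R.
Proof.
move=> a x y; rewrite -[x]modreprK -[y]modreprK -modpiD !scaleq_pi -modpiD.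
by rewrite scalerDr.
Qed.
Lemma scaleqDl x : {morph scaleq^~ x : a b / a + b}.
Proof.
by move=> a b; rewrite -[x]modreprK !scaleq_pi scalerDl modpiD.
Qed.

HB.instance Definition _ :=
  GRing.Zmodule_isLmodule.Build R quotmod scaleqA scale1q scaleqDr scaleqDl.

Lemma modpi_linear : linear modpi.
Proof. by move=> a u v; rewrite modpiD -scaleq_pi. Qed.
HB.instance Definition _ :=
  GRing.isLinear.Build R V quotmod *:%R modpi modpi_linear.

End QuotientModule.

(** Linearity of the components comes from the uniqueness of decompositions: the
    family a f_x + f_y decomposes a x + y. *)
Lemma direct_sum_proj (R : comNzRingType) (M : lmodType R) (K : choiceType)
    (N : K -> {pred M}) : is_direct_sum N ->
  exists p : K -> M -> M,
    [/\ forall k x, p k x \in N k,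
        forall k a x y, p k (a *: x + y) = a *: p k x + p k y &
        forall x, exists S : {fset K}, x = \sum_(k <- S) p k x].
Proof.
move=> [smN /choice[f Hf]]; exists (fun k x => f x k); split=> [k x|k a x y|x].
- by case: (Hf x) => -[].
- pose S := (finsupp (f x) `|` finsupp (f y))%fset.
  pose h : {fsfun K -> M with 0} := [fsfun k in S => a *: f x k + f y k].
  have [[fxN xE] _] := Hf x; have [[fyN yE] _] := Hf y.
  have [_ funiq] := Hf (a *: x + y).
  have hE k' : h k' = a *: f x k' + f y k'.
    rewrite fsfunE; case: ifPn => //; rewrite in_fsetU negb_or => /andP[kx ky].
    by rewrite !fsfun_dflt // scaler0 addr0.
  rewrite -hE; congr (fun_of_fsfun _ _); apply: funiq; split=> [k'|].
    by rewrite hE; apply: (smN k').2.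
  have sumS (g : {fsfun K -> M with 0}) : (finsupp g `<=` S)%fset ->
      \sum_(k <- finsupp g) g k = \sum_(k <- S) g k.
    by move=> gS; apply: big_fset_incl => // k' _; apply: fsfun_dflt.
  rewrite [in LHS]xE [in LHS]yE !sumS ?fsubsetUl ?fsubsetUr ?finsupp_sub //.
  by rewrite scaler_sumr -big_split; apply: eq_bigr => k' _; rewrite hE.
- by exists (finsupp (f x)); case: (Hf x) => -[].
Qed.

Lemma quotmod_finitely_generated (R : comNzRingType) N (K : {pred 'rV[R]_N})
  (smK : GRing.submod_closed K) : finitely_generated (quotmod smK).
Proof.
pose g := [seq modpi smK (delta_mx 0 i) | i <- enum 'I_N].
have szg : N = size g by rewrite size_map size_enum_ord.
exists g => x; split=> // _; exists (fun i => modrepr x 0 (cast_ord (esym szg) i)).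
rewrite -[LHS](modreprK x) [in LHS](row_sum_delta (modrepr x)) linear_sum.
rewrite (reindex_onto (cast_ord szg) (cast_ord (esym szg))) /=; last first.
  by move=> i _; rewrite cast_ordKV.
apply: eq_big => i; first by rewrite cast_ordK eqxx.
move=> _; rewrite linearZ cast_ordK /=; congr (_ *: _).
by rewrite (nth_map i) ?size_enum_ord ?nth_ord_enum.
Qed.

(** The matrix lifts the projection of R^N/K onto one of its summands.  The
    components of the i0-th generator add up to that generator modulo K, hence
    modulo m, so one projection has a diagonal entry outside m there. *)
Lemma bounded_module_type_matrix (R : comNzRingType) (m : {pred R}) :
  ideal m -> 1 \notin m -> bounded_module_type R ->
  exists n, forall N (K : {pred 'rV[R]_N}), GRing.submod_closed K ->
    (forall v, v \in K -> forall j, v 0 j \in m) ->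
    forall i0, exists A : 'M[R]_N,
      [/\ forall v, v \in K -> v *m A \in K, A i0 i0 \notin m &
          forall f : 'I_n.+1 -> 'I_N, \det (mxsub f f A) \in m].
Proof.
move=> idm m1 [n n0 bmt]; exists n => N K smK Km i0.
have [I [S [dsS genS]]] := bmt _ (quotmod_finitely_generated smK).
have [p [pS plin psum]] := direct_sum_proj dsS.
pose e i : 'rV[R]_N := delta_mx 0 i.
pose A k : 'M[R]_N := \matrix_i modrepr (p k (modpi smK (e i))).
have piA k v : modpi smK (v *m A k) = p k (modpi smK v).
  pose pk : {linear quotmod smK -> quotmod smK} :=
    HB.pack (p k) (GRing.isLinear.Build R _ _ *:%R (p k) (plin k)).
  rewrite mulmx_sum_row {2}[v]row_sum_delta -[p k]/(pk : _ -> _) !linear_sum.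
  by apply: eq_bigr => i _; rewrite !linearZ rowK /= modreprK.
have stabA k v : v \in K -> v *m A k \in K.
  move=> vK; rewrite -modpi_eq0 piA.
  have -> : modpi smK v = 0 by apply/eqP; rewrite modpi_eq0.
  by have := plin k (-1) 0 0; rewrite !scaleN1r !addNr => ->.
have [k Ak] : exists k, A k i0 i0 \notin m.
  apply: contrapT => Am; case/negP: m1.
  have [T eE] := psum (modpi smK (e i0)).
  have : e i0 - \sum_(k <- T) row i0 (A k) \in K.
    rewrite -(modpi_eq smK) linear_sum {1}eE; apply/eqP/eq_bigr => k _.
    by rewrite rowK /= modreprK.
  move/Km/(_ i0); rewrite !mxE !eqxx summxE => sm.
  rewrite -[1](subrK (\sum_(k <- T) row i0 (A k) 0 i0)).
  apply: (idealD idm sm); apply: (ideal_sum idm) => k _; rewrite mxE.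
  by apply: contrapT => kA; apply: Am; exists k; apply/negP.
exists (A k); split=> [||f] //; first exact: stabA.
have [g szg gS] := genS k.
have /choice[c cE] i : exists c : 'I_(size g) -> R,
    p k (modpi smK (e i)) = \sum_(l < size g) c l *: g`_l by apply/gS.
pose c' i l := if insub l is Some l' then c i l' else 0.
pose C : 'M[R]_(N, n) := \matrix_(i, l) c' i l.
pose Y : 'M[R]_(n, N) := \matrix_l modrepr g`_l.
have ACY i j : A k i j - (C *m Y) i j \in m.
  suff /Km/(_ j) : row i (A k) - row i C *m Y \in K by rewrite -row_mul !mxE.
  rewrite -(modpi_eq smK) rowK modreprK cE mulmx_sum_row linear_sum.
  rewrite (eq_bigr (fun l : 'I__ => c' i l *: g`_l)); last first.
    by move=> l _; rewrite /c' valK.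
  rewrite (big_ord_widen _ (fun l => c' i l *: g`_l) szg) big_mkcond /=.
  apply/eqP/eq_bigr => l _; rewrite linearZ /= rowK modreprK !mxE.
  by case: ifP => // lg; rewrite /c' insubF // scale0r.
(* A zero column pads the factor on n columns to a square one. *)
have detCY0 : \det (row_mx (0 : 'cV_n.+1) (rowsub f C) *m
                    col_mx (0 : 'rV_n.+1) (colsub f Y)) = 0.
  rewrite det_mulmx (expand_det_col _ ord0) big1 ?mul0r // => i _.
  have Z : row_mx (0 : 'cV_n.+1) (rowsub f C) i (lshift n 0) = 0.
    by rewrite row_mxEl mxE.
  have ->: ord0 = lshift n (0 : 'I_1) by apply: val_inj.
  by rewrite [X in X * _]Z mul0r.
rewrite -[\det _]subr0 -detCY0; apply: (ideal_detB idm) => i j.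
rewrite mul_row_col mul0mx add0r -mxsub_mul.
rewrite [mxsub f f (A k) i j]mxE [mxsub f f _ i j]mxE; exact: ACY.
Qed.

(** * Local rings of bounded module type are valuation rings *)

Section LocalRing.
Variables (R : comNzRingType) (m : {pred R}).
Hypotheses (idm : ideal m) (m1 : 1 \notin m).
Hypothesis m_unit : forall x, x \notin m -> exists y, x * y = 1.

Lemma nonmemM x y : x \notin m -> y \notin m -> x * y \notin m.
Proof.
move=> /m_unit[u xu] /m_unit[v yv]; apply/negP => /(ideal_mulr idm (u * v)).
by rewrite mulrACA xu yv mulr1 (negbTE m1).
Qed.

Lemma nonmemD x y : x \notin m -> y \in m -> x + y \notin m.
Proof.
move=> xm ym; apply: contraNN xm => xym.
by rewrite -[x](addrK y); apply: idealB.
Qed.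

(** Replacing the entries above the diagonal by 0 changes the determinant by an
    element of m only. *)
Lemma det_trig_nonmem n (B : 'M[R]_n) :
  (forall i j : 'I_n, (i < j)%N -> B i j \in m) ->
  (forall i, B i i \notin m) -> \det B \notin m.
Proof.
move=> Blt Bii.
pose T : 'M[R]_n := \matrix_(i, j) if (i < j)%N then 0 else B i j.
have BT : \det B - \det T \in m.
  apply: (ideal_detB idm) => i j; rewrite mxE; case: ifPn => [ij|_].
    by rewrite subr0 Blt.
  by rewrite subrr ideal0.
rewrite -[\det B](subrK (\det T)) addrC; apply: nonmemD => //.
rewrite det_trig; last by apply/is_trig_mxP => i j ij; rewrite mxE ij.
elim/big_ind: _ => //; first exact: nonmemM.
by move=> i _; rewrite mxE ltnn.
Qed.

Lemma nondivisor_nonunit a x : ~ divides a x -> a \in m.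
Proof.
move=> nax; apply: contrapT => /negP/m_unit[y ay]; apply: nax.
by exists (y * x); rewrite mulrA ay mul1r.
Qed.

Section Pencil.
Variables (a b : R).
Hypotheses (nab : ~ divides a b) (nba : ~ divides b a).

(* Q is the ideal a m + b m, modulo which a and b are independent over R/m. *)
Let Q x := exists p q, [/\ p \in m, q \in m & x = a * p + b * q].

Lemma pencil_indep x y : Q (a * x - b * y) -> x \in m /\ y \in m.
Proof.
move=> [p [q [pm qm E]]].
have {}E : a * (x - p) = b * (y + q).
  by rewrite mulrBr; apply/eqP; rewrite subr_eq addrC mulrDr addrCA -E; apply/eqP; ring.
split; apply: contrapT => /negP N.
  have /m_unit[u xu] : x - p \notin m by apply: nonmemD => //; apply: idealN.
  by apply: nba; exists ((y + q) * u); rewrite mulrA -E -mulrA xu mulr1.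
have /m_unit[u yu] : y + q \notin m by apply: nonmemD.
by apply: nab; exists ((x - p) * u); rewrite mulrA E -mulrA yu mulr1.
Qed.

Let shift (c : nat -> R) j := if j is j'.+1 then c j' else 0.

(* Modulo Q, a member of K is the sum over l < n of c l (a e_l - b e_(l+1)): the
   vanishing of c beyond n restricts the sum, and shift moves the second term. *)
Let K n : {pred 'rV[R]_n.+1} := fun v =>
  `[< exists c : nat -> R, (forall l, (n <= l)%N -> c l = 0) /\
      forall j : 'I_n.+1, Q (v 0 j - (a * c j - b * shift c j)) >].

Lemma pencil_submod n : GRing.submod_closed (@K n).
Proof.
split=> [|r u v /asboolP[c [c0 cQ]] /asboolP[d [d0 dQ]]]; apply/asboolP.
  exists (fun=> 0); split=> // j; exists 0, 0.
  by rewrite !(ideal0 idm) mxE /shift; split=> //; case: (j : nat) => [|?]; ring.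
exists (fun l => r * c l + d l); split=> [l nl|j].
  by rewrite c0 // d0 // mulr0 addr0.
have [[p [q [pm qm E]]] [p' [q' [pm' qm' E']]]] := (cQ j, dQ j).
exists (r * p + p'), (r * q + q').
split; [by apply: idm.2 | by apply: idm.2 |].
have shE : shift (fun l => r * c l + d l) j = r * shift c j + shift d j.
  by rewrite /shift; case: (j : nat) => [|?]; ring.
rewrite shE !mxE.
have -> : u 0 j = a * p + b * q + (a * c j - b * shift c j) by rewrite -E; ring.
have -> : v 0 j = a * p' + b * q' + (a * d j - b * shift d j) by rewrite -E'; ring.
ring.
Qed.

Lemma pencil_max n v : v \in @K n -> forall j, v 0 j \in m.
Proof.
move=> /asboolP[c [_ cQ]] j; have [p [q [_ _ E]]] := cQ j.
rewrite -[v 0 j](subrK (a * c j - b * shift c j)) E.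
have [am bm] := (nondivisor_nonunit nab, nondivisor_nonunit nba).
by rewrite (idealD idm) ?(idealB idm) ?(idealD idm) ?(ideal_mulr idm).
Qed.

(** Applying A to the relation a e_i - b e_(i+1) and comparing the coefficients of
    a and b modulo m shows that the rows i and i+1 of A are the same sequence c up
    to a shift.  So A is Toeplitz modulo m; since c vanishes at n, so does the last
    column above its bottom entry, hence everything above the diagonal. *)
Lemma pencil_stable n (A : 'M[R]_n.+1) :
  (forall v, v \in @K n -> v *m A \in @K n) ->
  (forall i j : 'I_n.+1, (i < j)%N -> A i j \in m) /\
  (forall i, A i i - A ord0 ord0 \in m).
Proof.
move=> stA; pose A' i j := A (inord i) (inord j).
have step i : (i < n)%N -> exists c : nat -> R,
    (forall l, (n <= l)%N -> c l = 0) /\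
    forall j, (j <= n)%N -> A' i j - c j \in m /\ A' i.+1 j - shift c j \in m.
  move=> lt_in; pose v : 'rV[R]_n.+1 :=
    a *: delta_mx 0 (inord i) - b *: delta_mx 0 (inord i.+1).
  have /stA/asboolP[c [c0 cQ]] : v \in @K n.
    apply/asboolP; exists (fun l => (l == i)%:R); split=> [l|j].
      by move=> nl; rewrite (gtn_eqF (leq_trans lt_in nl)).
    exists 0, 0; rewrite (ideal0 idm); split=> //.
    have -> : shift (fun l => (l == i)%:R) j = (j == i.+1 :> nat)%:R.
      by rewrite /shift; case: (j : nat).
    by rewrite !mxE -!val_eqE /= !inordK ?ltnS // 1?ltnW // !mulr0 addr0 subrr.
  exists c; split=> // j jn; apply: pencil_indep.
  have := cQ (inord j); rewrite inordK ?ltnS // mulmxBl -!scalemxAl -!rowE !mxE.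
  by congr Q; rewrite /A'; ring.
have last_col i : (i < n)%N -> A' i n \in m.
  by move=> /step[c [c0 /(_ n (leqnn n))[]]]; rewrite c0 // subr0.
have toeplitz i j : (i < n)%N -> (j < n)%N -> A' i.+1 j.+1 - A' i j \in m.
  move=> /step[c [_ cA]] jn.
  have [[H1 _] [_ H2]] := (cA j (ltnW jn), cA j.+1 jn).
  by have := idealB idm H2 H1; congr (_ \in m); rewrite /shift; ring.
split=> [i j ij|i].
  have -> : A i j = A' i j by rewrite /A' !inord_val.
  have [k kE] : exists k, (n = j + k)%N.
    by exists (n - j)%N; rewrite subnKC // -ltnS.
  elim: k (i : nat) (j : nat) ij kE => [|k IH] {}i {}j ij jE.
    by rewrite addn0 in jE; rewrite -jE; apply: last_col; rewrite jE.
  have jn : (j < n)%N by lia.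
  have := toeplitz i j (ltn_trans ij jn) jn.
  move=> /(idealB idm (IH i.+1 j.+1 _ _)); rewrite opprB addrC subrK; apply; lia.
have -> : A i i = A' i i by rewrite /A' !inord_val.
have -> : A ord0 ord0 = A' 0 0.
  by rewrite /A'; congr (A _ _); apply: val_inj; rewrite /= inordK.
have : (i <= n)%N by rewrite -ltnS.
elim: (i : nat) => [|k IH] kn; first by rewrite subrr ideal0.
by have := idealD idm (toeplitz k k kn kn) (IH (ltnW kn)); rewrite addrA subrK.
Qed.

End Pencil.

(** The pencil attached to two incomparable elements has endomorphisms that are,
    modulo m, triangular with constant diagonal, on n+1 generators. *)
Lemma bounded_module_type_valuation : bounded_module_type R -> valuation_ring R.
Proof.
move=> /(bounded_module_type_matrix idm m1)[n bmt].
have total (a b : R) : divides a b \/ divides b a.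
  apply: contrapT => /not_orP[nab nba].
  have [A [stA A00 detA]] :=
    bmt _ _ (pencil_submod a b n) (@pencil_max _ _ nab nba n) ord0.
  have [Alt Aii] := pencil_stable nab nba stA.
  have /negP[] : \det (mxsub id id A) \notin m; last exact: detA.
  rewrite mxsub_id; apply: det_trig_nonmem => // i.
  by rewrite -[A i i](subrK (A ord0 ord0)) addrC; apply: nonmemD.
move=> I J idI idJ; apply: contrapT => /not_orP[nIJ nJI].
have pick (S T : {pred R}) : ~ {subset S <= T} -> exists2 x, x \in S & x \notin T.
  move=> nST; apply: contrapT => H; apply: nST => x xS.
  by apply: contrapT => xT; apply: H; exists x => //; apply/negP.
have [[x xI xJ] [y yJ yI]] := (pick _ _ nIJ, pick _ _ nJI).
have [[c E]|[c E]] := total x y.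
  by rewrite E (ideal_mulr idI) in yI.
by rewrite E (ideal_mulr idJ) in xJ.
Qed.

End LocalRing.

(** * Pseudo-limits in a valuation ring *)

Section Divides.
Variable R : comNzRingType.
Implicit Types a b c x y : R.

Lemma divides_refl a : divides a a. Proof. by exists 1; rewrite mulr1. Qed.

Lemma divides_mulr a b : divides a (a * b). Proof. by exists b. Qed.

Lemma divides_mull a b : divides a (b * a). Proof. by exists b; rewrite mulrC. Qed.

Lemma divides_trans a b c : divides a b -> divides b c -> divides a c.
Proof. by move=> [x ->] [y ->]; exists (x * y); rewrite mulrA. Qed.

Lemma dividesMl a b x : divides a b -> divides a (x * b).
Proof. by move=> ab; apply: divides_trans ab (divides_mull _ _). Qed.

Lemma dividesMr a b x : divides a b -> divides a (b * x).
Proof. by rewrite mulrC; apply: dividesMl. Qed.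

Lemma dividesD a x y : divides a x -> divides a y -> divides a (x + y).
Proof. by move=> [u ->] [v ->]; exists (u + v); rewrite mulrDr. Qed.

Lemma dividesN a x : divides a x -> divides a (- x).
Proof. by move=> [u ->]; exists (- u); rewrite mulrN. Qed.

Lemma dividesB a x y : divides a x -> divides a y -> divides a (x - y).
Proof. by move=> ax /dividesN; apply: dividesD. Qed.

Lemma divides_sum a (J : Type) (r : seq J) (Q : pred J) (F : J -> R) :
  (forall i, Q i -> divides a (F i)) -> divides a (\sum_(i <- r | Q i) F i).
Proof.
move=> aF; elim/big_ind: _ => //; last exact: dividesD.
by exists 0; rewrite mulr0.
Qed.

Lemma divides_mem (I : {pred R}) a x : ideal I -> a \in I -> divides a x -> x \in I.
Proof. by move=> idI aI [c ->]; apply: ideal_mulr. Qed.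

Lemma divides_exp a i j : (i <= j)%N -> divides (a ^+ i) (a ^+ j).
Proof. by move=> ij; exists (a ^+ (j - i)); rewrite -exprD subnKC. Qed.

End Divides.

Lemma valuation_divides (R : comNzRingType) (a b : R) :
  valuation_ring R -> divides a b \/ divides b a.
Proof.
move/(_ _ _ (ideal_principal a) (ideal_principal b)) => [sub|sub].
  by right; apply/principalP/sub/principalP/divides_refl.
by left; apply/principalP/sub/principalP/divides_refl.
Qed.

(** A chain of cosets whose ideals intersect in I is recorded by one
    representative r a for each modulus a outside I; values of r on I are junk. *)
Definition coherent (R : comNzRingType) (I : {pred R}) (r : R -> R) : Prop :=
  forall a b, a \notin I -> b \notin I -> divides a b -> divides a (r b - r a).

Definition pseudo_limit (R : comNzRingType) (I : {pred R}) (r : R -> R) (x : R) : Prop :=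
  forall a, a \notin I -> divides a (x - r a).

(** For a prime J this means that I is the trace on R of an ideal of the
    localization of R at J; for I = J it means that J is prime or all of R. *)
Definition saturated (R : comNzRingType) (J I : {pred R}) : Prop :=
  forall u a, u \notin J -> u * a \in I -> a \in I.

Section Valuation.
Variables (R : comNzRingType) (m : {pred R}).
Hypotheses (idm : ideal m) (m1 : 1 \notin m).
Hypothesis m_unit : forall x, x \notin m -> exists y, x * y = 1.
Hypothesis valR : valuation_ring R.

Lemma divides_nonmem (I : {pred R}) (a x : R) :
  ideal I -> a \notin I -> x \in I -> divides a x.
Proof.
move=> idI aI xI; have [//|xa] := valuation_divides a x valR.
by rewrite (divides_mem idI xI xa) in aI.
Qed.

Lemma common_multiple (I : {pred R}) (a b : R) : a \notin I -> b \notin I ->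
  exists c, [/\ c \notin I, divides a c & divides b c].
Proof.
move=> aI bI; have [ab|ba] := valuation_divides a b valR.
  by exists b; split=> //; apply: divides_refl.
by exists a; split=> //; apply: divides_refl.
Qed.

(** 1 - p w is a unit and kills x when x = x p w. *)
Lemma nakayama (x p : R) : p \in m -> divides (x * p) x -> x = 0.
Proof.
move=> pm [w E]; have /m_unit[u uE] : 1 - p * w \notin m.
  by apply: (nonmemD idm) => //; apply/(idealN idm)/(ideal_mulr idm).
by rewrite -[x]mulr1 -uE mulrA mulrBr mulr1 mulrA -E subrr mul0r.
Qed.

(** Zero-divisors are harmless as long as c y is nonzero: otherwise y = x p with p
    in m, so c y divides c x and c x = 0 by Nakayama. *)
Lemma divides_cancel (c x y : R) : divides (c * y) (c * x) -> c * y != 0 -> divides y x.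
Proof.
move=> cyx cy0; have [//|[p yE]] := valuation_divides y x valR.
have [pm|/m_unit[u pu]] := boolP (p \in m); last first.
  by exists u; rewrite yE -mulrA pu mulr1.
have cx0 : c * x = 0 by apply: (nakayama pm); rewrite -mulrA -yE.
by rewrite yE mulrA cx0 mul0r eqxx in cy0.
Qed.

(** For a outside the intersection I0, choose a member of the chain whose ideal
    misses a and hence consists of multiples of a; its representative serves as
    r' a.  An ideal of the chain equal to I0 would put its representative in all
    the cosets; if there is none, a pseudo-limit lies in every coset. *)
Lemma almost_maximal_pseudo_limit :
  (forall (I : {pred R}) (r : R -> R), ideal I ->
    (exists2 y, y != 0 & y \in I) -> coherent I r -> exists x, pseudo_limit I r x) ->
  almost_maximal R.
Proof.
move=> lim L r I idI chain [y y0 yI]; apply: contrapT => nox.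
pose I0 : {pred R} := fun z => `[< forall l, z \in I l >].
have idI0 : ideal I0.
  split=> [|a u v /asboolP uI /asboolP vI]; apply/asboolP => l.
    exact: ideal0.
  by apply: (idI l).2.
have diff l l' : r l - r l' \in I l \/ r l - r l' \in I l'.
  have cosetr k : r k \in coset (r k) (I k) by rewrite /coset !inE subrr ideal0.
  have [/(_ _ (cosetr l))|/(_ _ (cosetr l'))] := chain l l'; rewrite !inE; first by right.
  by left; rewrite -opprB idealN.
have big l : exists2 a, a \in I l & a \notin I0.
  apply: contrapT => H; apply: nox; exists (r l) => l'; rewrite /coset !inE.
  have [rl|//] := diff l l'; apply: contrapT => rl'; apply: H.
  by exists (r l - r l') => //; apply/asboolP => /(_ l').
have /choice[r' r'E] a : exists z, a \notin I0 -> exists2 l, a \notin I l & z = r l.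
  have [aI0|/asboolP/existsNP[l /negP aIl]] := boolP (a \in I0).
    by exists 0.
  by exists (r l) => _; exists l.
have [||x xlim] := lim I0 r' idI0.
- by exists y => //; apply/asboolP.
- move=> a b aI0 bI0 ab; have [l al ->] := r'E _ aI0; have [l' bl' ->] := r'E _ bI0.
  have [H|H] := diff l' l; last exact: divides_nonmem H.
  by apply: divides_trans ab _; apply: divides_nonmem H.
apply: nox; exists x => l; rewrite /coset !inE.
have [a aIl aI0] := big l; have [l' al' r'a] := r'E _ aI0.
rewrite -[x](subrK (r' a)) -addrA; apply: idealD => //.
  by apply: divides_mem (xlim _ aI0).
rewrite r'a; have [H|//] := diff l' l.
by apply: (divides_mem _ aIl) => //; apply: divides_nonmem H.
Qed.

(** Suppose u a is in I with a outside I and u outside J.  For the b with a b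
    outside I, the differences r (a b) - r a are multiples a c_b, and c_b is
    determined modulo b because a b != 0.  All these b divide u, so they are
    outside J and divide every element of J.  The cosets of the c_b in R/J have a
    common point, as all their ideals contain the nonzero class of u; it lifts to
    x' with b dividing each x' - c_b, and r a + a x' is a pseudo-limit. *)
Lemma pseudo_limit_saturated (J : prime_idealr R) (I : {pred R}) (r : R -> R) :
  almost_maximal {ideal_quot J} -> ideal I -> coherent I r ->
  ~ (exists x, pseudo_limit I r x) -> saturated J I.
Proof.
move=> amJ idI cohr nolim u a uJ uaI; apply: contrapT => /negP aI; apply: nolim.
pose L := {b : R | a * b \notin I}.
have /choice[c cE] (b : L) : exists c, r (a * sval b) - r a = a * c.
  by apply: cohr => //; [apply: (svalP b) | apply: divides_mulr].
pose pi : R -> {ideal_quot J} := \pi%qT.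
have cdiff (b b' : L) : divides (sval b) (sval b') ->
    divides (sval b) (c b' - c b).
  move=> bb'; apply: (@divides_cancel a); last first.
    by apply: contraNneq (svalP b) => ->; apply: ideal0.
  have -> : a * (c b' - c b) = r (a * sval b') - r (a * sval b).
    by rewrite mulrBr -!cE opprB addrA subrK.
  apply: cohr; [exact: (svalP b) | exact: (svalP b') |].
  by case: bb' => w ->; exists w; rewrite mulrA.
have bu (b : L) : divides (sval b) u.
  have [//|[w uw]] := valuation_divides (sval b) u valR.
  by have /negP[] := svalP b; rewrite uw mulrA [a * u]mulrC ideal_mulr.
have bJ (b : L) : sval b \notin J.
  by apply: contraNN uJ => bJ; case: (bu b) => w ->; rewrite prime_idealrM bJ.
have [b|b b'||x xE] := amJ L (fun b => pi (c b)) (fun b => principal (pi (sval b))).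
- exact: ideal_principal.
- have nested (b1 b2 : L) : divides (sval b1) (sval b2) ->
      {subset coset (pi (c b2)) (principal (pi (sval b2)))
       <= coset (pi (c b1)) (principal (pi (sval b1)))}.
    move=> b12 z; rewrite /coset !inE => /principalP[w zE]; apply/principalP.
    have [v cv] := cdiff _ _ b12; have [t bt] := b12.
    exists (pi t * w + pi v); rewrite mulrDr mulrA.
    have piM y y' : pi y * pi y' = pi (y * y') by rewrite /pi rmorphM.
    rewrite !piM -bt -cv -zE /pi rmorphB /=; ring.
  by have [/nested|/nested] := valuation_divides (sval b) (sval b') valR; [right|left].
- exists (pi u).
    by rewrite /pi -(raddf0 \pi_{ideal_quot J}%qT) -Quotient.idealrBE subr0.
  move=> b; apply/principalP; case: (bu b) => w ->; exists (pi w).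
  by rewrite /pi rmorphM.
pose x' := repr x; have cx' (b : L) : divides (sval b) (x' - c b).
  have := xE b; rewrite /coset !inE => /principalP[z].
  rewrite -[x]reprK -[z]reprK /pi -rmorphB -rmorphM => /eqP.
  rewrite -Quotient.idealrBE => xJ.
  rewrite -[x' - c b](subrK (sval b * repr z)); apply: dividesD; last exact: divides_mulr.
  have [//|[w bE]] := valuation_divides (sval b) (x' - c b - sval b * repr z) valR.
  by have /negP[] := bJ b; rewrite bE prime_idealrM xJ.
exists (r a + a * x') => e eI.
have [[b eE]|[w aE]] := valuation_divides a e valR; last first.
  rewrite addrAC; apply: dividesD; last by rewrite aE -mulrA; apply: divides_mulr.
  by apply: cohr => //; exists w.
have abI : a * b \notin I by rewrite -eE.
have := cE (exist _ b abI); have [w /= cw] := cx' (exist _ b abI); rewrite -eE => re.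
by exists w; rewrite [in RHS]eE -mulrA -cw mulrBr -re; ring.
Qed.

End Valuation.

(** * A module without small decomposition *)

Section SaturatedSystem.
Variables (R : comNzRingType) (m J I : {pred R}) (r : R -> R).
Hypotheses (idm : ideal m) (m1 : 1 \notin m).
Hypothesis m_unit : forall x, x \notin m -> exists y, x * y = 1.
Hypothesis valR : valuation_ring R.
Hypotheses (idI : ideal I) (I1 : 1 \notin I) (satI : saturated J I).
Hypotheses (cohr : coherent I r) (nolim : ~ exists x, pseudo_limit I r x).

Lemma saturated_sub x : x \in I -> x \in J.
Proof.
move=> xI; apply: contrapT => /negP xJ; case/negP: I1.
by apply: (satI xJ); rewrite mulr1.
Qed.

(** If u xi = v with u outside J, then u divides v and the quotient x would be a
    pseudo-limit: where x - r a = e with a = e p a proper multiple of e, going to a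
    smaller modulus keeps x - r c equal to e up to a unit, so that u e becomes
    divisible by u a = u e p and vanishes, against u a being outside I. *)
Lemma linear_pseudo_limit u v :
  (forall a, a \notin I -> divides a (v - u * r a)) -> u \in J.
Proof.
move=> uv; apply: contrapT => /negP uJ; apply: nolim.
have uI : u \notin I by apply: contraNN uJ; apply: saturated_sub.
have [x vE] : divides u v.
  by rewrite -[v](subrK (u * r u)); apply: dividesD (divides_mulr _ _); apply: uv.
exists x => a aI; have [//|[p aE]] := valuation_divides a (x - r a) valR.
set e := x - r a in aE *.
have [pm|/m_unit[w pw]] := boolP (p \in m); last first.
  by exists w; rewrite aE -mulrA pw mulr1.
have uaI : u * a \notin I by apply: contraNN aI; apply: satI.
have [c [cI ac uac]] := common_multiple valR aI uaI.
(* x - r c is e times a unit, so c, hence u * e * p, divides u * e. *)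
have [w cw] := cohr aI cI ac.
have /m_unit[t pwt] : 1 - p * w \notin m.
  by apply: (nonmemD idm) => //; apply/(idealN idm)/(ideal_mulr idm).
have ue0 : u * e = 0.
  apply: (nakayama idm m1 m_unit pm); rewrite -mulrA -aE.
  apply: divides_trans uac _; have [z cz] := uv _ cI; exists (z * t).
  rewrite mulrA -cz vE -mulrBr -[u * e]mulr1 -pwt mulrA; congr (_ * t).
  have -> : x - r c = e - (r c - r a) by rewrite /e; ring.
  by rewrite cw aE; ring.
by case/negP: uaI; rewrite aE mulrA ue0 mul0r ideal0.
Qed.

Variable s : R.
Hypotheses (sm : s \in m) (rs : forall b, b \notin I -> divides s b -> divides s (r b)).
Hypotheses (idJ : ideal J) (sJ : forall k, s ^+ k \notin J).
Hypothesis satJ : saturated J J.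

Lemma exp_notin k : s ^+ k \notin I.
Proof. by apply: contraNN (sJ k); apply: saturated_sub. Qed.

Lemma exp_divides k x : x \in J -> divides (s ^+ k) x.
Proof. exact: divides_nonmem. Qed.

Section Module.
Variables (q : nat) (d0 : R).
Hypotheses (q0 : (0 < q)%N) (d0I : d0 \in I) (dn0 : s ^+ (q * q) * d0 != 0).

Let d i := s ^+ (q * i) * d0.

Let dI i : d i \in I. Proof. exact: ideal_mull. Qed.

Let dN0 i : (i <= q)%N -> d i != 0.
Proof.
move=> iq; apply: contraNneq dn0 => di0.
by rewrite -(subnKC (leq_mul (leqnn q) iq)) exprD mulrAC -/(d i) di0 mul0r.
Qed.

Let e (i : 'I_q) : 'I_(q + 1) := lshift 1 i.
Let f : 'I_(q + 1) := rshift q ord0.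

(** The relations between the generators e_i and f = xi (sum of the s^i e_i), when
    d i generates the annihilator of e_i.  As xi is only known through its
    approximations, the coordinates are evaluated at r b and have to be multiples
    of the d i for all sufficiently small moduli b. *)
Definition limit_relations : {pred 'rV[R]_(q + 1)} := fun v =>
  `[< exists2 a, a \notin I & forall b, b \notin I -> divides a b ->
      forall i : 'I_q, divides (d i) (v 0 (e i) + v 0 f * s ^+ i * r b) >].

Lemma limit_relations_submod : GRing.submod_closed limit_relations.
Proof.
split=> [|x u v /asboolP[a aI ua] /asboolP[a' a'I va']]; apply/asboolP.
  by exists 1 => // b _ _ i; exists 0; rewrite !mxE; ring.
have [c [cI ac a'c]] := common_multiple valR aI a'I.
exists c => // b bI cb i; rewrite !mxE.
have H1 := ua b bI (divides_trans ac cb) i.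
have H2 := va' b bI (divides_trans a'c cb) i.
have := dividesD (dividesMl x H1) H2.
by congr (divides _ _); ring.
Qed.

(** A relation with a unit coefficient at f would express xi, up to multiples of
    d 0 in I, by an element of R. *)
Lemma limit_relations_max v : v \in limit_relations -> forall j, v 0 j \in m.
Proof.
move=> /asboolP[a aI va].
have Im x : x \in I -> x \in m.
  move=> xI; apply: (@nondivisor_nonunit _ _ m_unit _ 1) => x1.
  by case/negP: I1; apply: divides_mem xI x1.
have fm : v 0 f \in m.
  apply: contrapT => /negP/m_unit[w fw]; apply: nolim.
  exists (- (v 0 (e (Ordinal q0)) * w)) => b bI.
  have [c [cI ac bc]] := common_multiple valR aI bI.
  have := va c cI ac (Ordinal q0); rewrite /= expr0 mulr1 => H.
  have {}H : divides b (v 0 (e (Ordinal q0)) + v 0 f * r c).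
    by apply: divides_trans H; apply: divides_nonmem bI (dI 0).
  have := dividesB (cohr bI cI bc) (dividesMl w H).
  by congr (divides _ _); rewrite mulrDr mulrA [w * v 0 f]mulrC fw; ring.
move=> j; have [i ->|i ->] := split_ordP j; last by rewrite (ord1 i).
rewrite -[v 0 _](addrK (v 0 f * s ^+ i * r a)).
apply: (idealB idm); last by do 2!apply: (ideal_mulr idm).
apply: Im; apply: divides_mem (dI i) _ => //.
by apply: va => //; apply: divides_refl.
Qed.

Variable A : 'M[R]_(q + 1).
Hypothesis stA : forall v, v \in limit_relations -> v *m A \in limit_relations.

(** As d j kills the image of e_j, d i = s^(q (i - j)) d j divides d j times its
    i-th coordinate.  That coordinate is the matrix entry plus a multiple of
    s^i xi, and xi is itself divisible by s. *)
Lemma limit_relations_lower (j i : 'I_q) :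
  (j < i)%N -> divides (s ^+ i.+1) (A (e j) (e i)).
Proof.
move=> ji; pose v : 'rV[R]_(q + 1) := d j *: delta_mx 0 (e j).
have /stA/asboolP[a aI va] : v \in limit_relations.
  apply/asboolP; exists 1 => // b _ _ k.
  rewrite !mxE /= eq_rlshift mulr0 !mul0r addr0 (inj_eq (@lshift_inj _ _)).
  case: eqP => [->|_]; last by exists 0; rewrite !mulr0.
  by rewrite mulr1; apply: divides_refl.
have sI : s \notin I by rewrite -[s]expr1; apply: exp_notin.
have [b [bI ab sb]] := common_multiple valR aI sI.
have dE : d i = d j * s ^+ (q * (i - j)).
  by rewrite /d mulrAC -exprD -mulnDr subnKC // ltnW.
have /(divides_cancel idm m1 m_unit valR) :
    divides (d j * s ^+ (q * (i - j)))
            (d j * (A (e j) (e i) + A (e j) f * (s ^+ i * r b))).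
  rewrite -dE; have := va b bI ab i; rewrite -scalemxAl -rowE !mxE.
  by congr (divides _ _); rewrite mulrDr !mulrA.
rewrite -dE => /(_ (dN0 (ltnW (ltn_ord i)))) sA.
rewrite -[A _ _](addrK (A (e j) f * (s ^+ i * r b))); apply: dividesB.
  apply: divides_trans sA; apply: divides_exp.
  by have := ltn_ord i; nia.
apply: dividesMl; have [w ->] := rs bI sb.
by exists w; rewrite exprSr mulrA.
Qed.

(* z is the image under A of the vector sum of the s^j e_j, whose multiple by xi
   is f. *)
Let z k := \sum_(j < q) s ^+ j * A (e j) k.

(** For t a = d q, the vector t (f - r a (sum of the s^j e_j)) is a relation, and
    so is its image.  The approximation r a' enters the i-th coordinate through
    the coefficient of f, with the factor s^i; subtracting s^i times the
    coordinate 0 cancels it.  What is left says that s^(q q) (z_i - s^i z_0) xi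
    is congruent to one element of R modulo every a outside I. *)
Lemma limit_relations_eigen (i : 'I_q) :
  z (e i) - s ^+ i * z (e (Ordinal q0)) \in J.
Proof.
set o := Ordinal q0.
apply: (satJ (sJ (q * q))).
apply: (@linear_pseudo_limit _ (s ^+ (q * q) * (A f (e i) - s ^+ i * A f (e o)))).
move=> a aI.
have [t dE] : divides a (s ^+ (q * q) * d0) := divides_nonmem valR idI aI (dI q).
pose v : 'rV[R]_(q + 1) := row_mx (\row_j (- (t * s ^+ j * r a))) (const_mx t).
have /stA/asboolP[a' a'I va] : v \in limit_relations.
  apply/asboolP; exists a => // b bI ab k.
  rewrite row_mxEl row_mxEr !mxE; have [w bw] := cohr aI bI ab.
  apply: (@divides_trans _ _ (s ^+ (q * q) * d0)).
    exists (s ^+ (q * q - q * k)); rewrite mulrAC -exprD subnKC //.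
    by rewrite leq_mul2l ltnW ?orbT.
  exists (s ^+ k * w); rewrite dE.
  have -> : - (t * s ^+ k * r a) + t * s ^+ k * r b = t * s ^+ k * (r b - r a) by ring.
  by rewrite bw; ring.
have vAE k : (v *m A) 0 k = t * (A f k - r a * z k).
  rewrite mxE big_split_ord /= big_ord1 row_mxEr mxE mulrBr addrC; congr (_ + _).
  rewrite mulrA mulr_sumr -sumrN; apply: eq_bigr => j _.
  by rewrite row_mxEl mxE; ring.
have H := va a' a'I (divides_refl _).
have {}H k : divides d0 (t * (A f (e k) - r a * z (e k)) +
                          t * (A f f - r a * z f) * s ^+ k * r a').
  by rewrite -!vAE; apply: divides_trans (H k); apply: divides_mull.
have {H} [w Hw] := dividesB (H i) (dividesMl (s ^+ i) (H o)).
apply: (@divides_cancel _ _ idm m1 m_unit valR t); last by rewrite mulrC -dE.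
by rewrite [t * a]mulrC -dE; exists w; rewrite -[RHS]mulrA -Hw /= expr0; ring.
Qed.

(** In the i-th coordinate of the eigenvector equation all the terms but
    s^i A_ii and s^i z_0 are divisible by s^(i+1), and so is J; cancelling s^i
    leaves A_ii = z_0 modulo s. *)
Lemma limit_relations_det :
  A (e (Ordinal q0)) (e (Ordinal q0)) \notin m -> \det (mxsub e e A) \notin m.
Proof.
set o := Ordinal q0 => A0.
have diag i : A (e i) (e i) - z (e o) \in m.
  suff : divides s (A (e i) (e i) - z (e o)) by apply: (divides_mem idm sm).
  apply: (@divides_cancel _ _ idm m1 m_unit valR (s ^+ i)); rewrite -exprSr; last first.
    by apply: contraNneq (sJ i.+1) => ->; apply: ideal0.
  have := exp_divides i.+1 (limit_relations_eigen i).
  rewrite /z (bigD1 i) //= -/(z _) => H.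
  have rest : divides (s ^+ i.+1) (\sum_(j < q | j != i) s ^+ j * A (e j) (e i)).
    apply: divides_sum => j ji; have [lt_ji|lt_ij|/val_inj E] := ltngtP j i.
    - exact/dividesMl/limit_relations_lower.
    - by apply/dividesMr/divides_exp.
    - by rewrite E eqxx in ji.
  by have := dividesB H rest; congr (divides _ _); ring.
apply: (det_trig_nonmem idm m1 m_unit) => [i j ij|i]; rewrite mxE.
  apply: (divides_mem idm sm); apply: divides_trans (limit_relations_lower ij).
  by rewrite -[s in divides s _]expr1; apply: divides_exp.
have -> : A (e i) (e i) = A (e o) (e o) +
    ((A (e i) (e i) - z (e o)) - (A (e o) (e o) - z (e o))).
  by ring.
by apply: (nonmemD idm) => //; apply: (idealB idm).
Qed.

End Module.

(** Any d != 0 in I is a multiple of every power of s, so the annihilators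
    s^(q i) d0, for i <= q, can be taken inside I and nonzero. *)
Lemma saturated_not_bounded : (exists2 y, y != 0 & y \in I) -> ~ bounded_module_type R.
Proof.
move=> [d dn0 dI] /(bounded_module_type_matrix idm m1)[n bmt].
pose q := n.+1; have q0 : (0 < q)%N by [].
have [d0 dE] : divides (s ^+ (q * q)) d := exp_divides _ (saturated_sub dI).
have d0I : d0 \in I by apply: (satI (sJ (q * q))); rewrite -dE.
rewrite dE in dn0.
have [A [stA A0 detA]] := bmt _ _ (limit_relations_submod q d0)
  (limit_relations_max q0 d0I) (lshift 1 (Ordinal q0)).
by have := limit_relations_det d0I dn0 stA A0; rewrite detA.
Qed.

End SaturatedSystem.

(** * The theorem *)

Theorem corollary9 (R : comNzRingType) :
  local_ring R ->
  bounded_module_type R ->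
  (exists J : prime_idealr R,
      ~ maximal_ideal J /\ almost_maximal {ideal_quot J}) ->
  valuation_ring R /\ almost_maximal R.
Proof.
move=> [m [idm m1 mmax] /local_nonmem_unit m_unit] bmt [J [Jnmax amJ]].
have valR := bounded_module_type_valuation idm m1 m_unit bmt.
split=> //; apply: (almost_maximal_pseudo_limit valR) => I r idI I_neq0 cohr.
apply: contrapT => nolim.
have idJ : ideal J.
  by split=> [|a u v uJ vJ]; [apply: rpred0 | apply: rpredD => //; apply: idealMr].
have I1 : 1 \notin I.
  apply/negP => I1; apply: nolim; exists 0 => a /negP[].
  by rewrite -[a]mulr1; apply: ideal_mull.
have [s sm sJ] : exists2 s, s \in m & s \notin J.
  apply: contrapT => mJ; apply: Jnmax.
  have {}mJ : {subset m <= J}.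
    by move=> x xm; apply: contrapT => xJ; apply: mJ; exists x => //; apply/negP.
  split=> // [|L idL JL L1 x]; first by rewrite idealr1.
  have Lm : L =i m by apply: mmax => // y /mJ/JL.
  by apply/idP/idP => [|/JL]; rewrite Lm // => /mJ.
have sXJ k : s ^+ k \notin J.
  elim: k => [|k IH]; first by rewrite idealr1.
  by rewrite exprS prime_idealrM negb_or sJ.
have satJ : saturated J J.
  by move=> u a uJ; rewrite prime_idealrM (negbTE uJ).
have satI := pseudo_limit_saturated idm m1 m_unit valR amJ idI cohr nolim.
have sI : s \notin I by apply: contraNN sJ; apply: (saturated_sub I1 satI).
(* Translating the system makes xi divisible by s. *)
have cohr' : coherent I (fun b => r b - r s).
  by move=> a b aI bI ab; rewrite opprB addrA subrK; apply: cohr.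
have nolim' : ~ exists x, pseudo_limit I (fun b => r b - r s) x.
  move=> [x xlim]; apply: nolim; exists (x + r s) => a /xlim.
  by congr (divides _ _); ring.
apply: (saturated_not_bounded idm m1 m_unit valR idI I1 satI cohr' nolim' sm) bmt => //.
by move=> b bI sb; apply: cohr.
Qed.
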